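(* (Maschke's Theorem for Doi-Hopf modules.) Let $(H,A,C)$ be a Doi-Hopf datum. If there exists a total $A$-integral $\gamma:C\to\mathrm{Hom}(C,A)$, then the forgetful functor $F:{}^C\mathcal M(H)_A\to\mathcal M_A$ is separable. If $H$ is a Hopf algebra, the converse holds. In this situation: (1) if a morphism $u:M\to N$ in ${}^C\mathcal M(H)_A$ has a retraction (resp. a section) that is right $A$-linear, then it has a retraction (resp. a section) in ${}^C\mathcal M(H)_A$; (2) if $M\in{}^C\mathcal M(H)_A$ is semisimple (resp. projective, injective) as a right $A$-module, then $M$ is semisimple (resp. projective, injective) as an object of ${}^C\mathcal M(H)_A$.
   Context: $k$ commutative ring; Sweedler notation $\Delta(c)=\sum c_{(1)}\otimes c_{(2)}$, $\rho(m)=\sum m_{<-1>}\otimes m_{<0>}$ (iterated $m_{<-2>}\otimes m_{<-1>}\otimes m_{<0>}$). A Doi-Hopf datum $(H,A,C)$: $H$ a bialgebra, $A$ a left $H$-comodule algebra (coaction $\rho_A$ an algebra map), $C$ a right $H$-module coalgebra ($\Delta(c\cdot h)=\sum c_{(1)}\cdot h_{(1)}\otimes c_{(2)}\cdot h_{(2)}$, $\varepsilon(c\cdot h)=\varepsilon(c)\varepsilon(h)$), with $C$ flat over $k$. ${}^C\mathcal M(H)_A$: right $A$-modules $M$ with left $C$-coaction such that $\rho_M(ma)=\sum m_{<-1>}\cdot a_{<-1>}\otimes m_{<0>}a_{<0>}$, morphisms $A$-linear $C$-colinear. An $A$-integral for $(H,A,C)$ is a $k$-linear $\gamma:C\to\mathrm{Hom}(C,A)$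 with, for all $a\in A$, $c,d\in C$: (i) $\sum a_{<0>}\gamma(c\cdot a_{<-2>})(d\cdot a_{<-1>})=\gamma(c)(d)\,a$; (ii) $\sum c_{(1)}\otimes\gamma(c_{(2)})(d)=\sum d_{(2)}\cdot\gamma(c)(d_{(1)})_{<-1>}\otimes\gamma(c)(d_{(1)})_{<0>}$ in $C\otimes A$. It is total (normalized) if $\sum\gamma(c_{(1)})(c_{(2)})=\varepsilon(c)1_A$ for all $c$. A functor $F$ is separable if $\mathrm{Hom}(M,N)\to\mathrm{Hom}(FM,FN)$ has a left inverse natural in $M,N$. *)

(* Defs.v *)
(* Doi-Hopf data over a commutative ring k, formalized
   without a library tensor product: tensor products of k-modules are given
   by their universal property (see TensorProduct), and the development is
   parameterized by an arbitrary choice [tp] of tensor products. *)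
From HB Require Import structures.
From mathcomp Require Import all_boot all_algebra.
Set Implicit Arguments.
Unset Strict Implicit.
Unset Printing Implicit Defensive.
Import GRing.Theory.
Local Open Scope ring_scope.

Section Tensor.
Variable k : comPzRingType.

Definition klinear (M N : lmodType k) (f : M -> N) :=
  forall (a : k) (x y : M), f (a *: x + y) = a *: f x + f y.
Definition kfunctional (M : lmodType k) (f : M -> k) :=
  forall (a : k) (x y : M), f (a *: x + y) = a * f x + f y.
Definition kbilinear (M N P : lmodType k) (f : M -> N -> P) :=
  (forall n : N, klinear (fun m : M => f m n)) /\ (forall m : M, klinear (f m)).

Record TensorProduct (M N : lmodType k) := {
  tens :> lmodType k;
  tmul : M -> N -> tens;
  tlift : forall P : lmodType k, (M -> N -> P) -> tens -> P;
  tmul_bilinear : kbilinear tmul;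
  tlift_linear : forall (P : lmodType k) (f : M -> N -> P),
      kbilinear f -> klinear (tlift f);
  tlift_tmul : forall (P : lmodType k) (f : M -> N -> P),
      kbilinear f -> forall m n, tlift f (tmul m n) = f m n;
  tens_ext : forall (P : lmodType k) (g h : tens -> P),
      klinear g -> klinear h -> (forall m n, g (tmul m n) = h (tmul m n)) ->
      forall t, g t = h t
}.

Definition tensor_provider := forall M N : lmodType k, TensorProduct M N.
End Tensor.

Section Ops.
Variables (k : comPzRingType) (tp : tensor_provider k).

Definition tt (M N : lmodType k) : lmodType k := tens (tp M N).
Definition tmu (M N : lmodType k) : M -> N -> tt M N := @tmul _ M N (tp M N).
Definition tli (M N P : lmodType k) (f : M -> N -> P) : tt M N -> P :=
  @tlift _ M N (tp M N) P f.
Definition tmap (M N M' N' : lmodType k) (f : M -> M') (g : N -> N') :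
  tt M N -> tt M' N' := tli (fun m n => tmu (f m) (g n)).
Definition tassoc (M N P : lmodType k) : tt M (tt N P) -> tt (tt M N) P :=
  tli (fun (m : M) (t : tt N P) => tli (fun n p => tmu (tmu m n) p) t).
Definition tact (X1 X2 X3 Y1 Y2 Y3 : lmodType k)
  (f : X1 -> X2 -> X3) (g : Y1 -> Y2 -> Y3) : tt X1 Y1 -> tt X2 Y2 -> tt X3 Y3 :=
  fun t s => tli (fun (x1 : X1) (y1 : Y1) =>
                    tli (fun x2 y2 => tmu (f x1 x2) (g y1 y2)) s) t.

Definition is_coalgebra (V : lmodType k) (D : V -> tt V V) (e : V -> k) :=
  [/\ klinear D, kfunctional e,
      forall c, tassoc (tmap id D (D c)) = tmap D id (D c),
      forall c, tli (fun x y => e x *: y) (D c) = c &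
      forall c, tli (fun x y => e y *: x) (D c) = c].

Record kAlgebra := {
  alg_sort :> lmodType k;
  amul : alg_sort -> alg_sort -> alg_sort;
  aone : alg_sort;
  amul_bilinear : kbilinear amul;
  amulA : associative amul;
  amul1 : left_id aone amul;
  amulr1 : right_id aone amul
}.

Record Bialgebra := {
  bi_alg :> kAlgebra;
  bDelta : bi_alg -> tt bi_alg bi_alg;
  beps : bi_alg -> k;
  bi_coalg : is_coalgebra bDelta beps;
  bDelta_mul : forall x y, bDelta (amul x y) = tact (@amul _) (@amul _) (bDelta x) (bDelta y);
  bDelta_one : bDelta (aone bi_alg) = tmu (aone bi_alg) (aone bi_alg);
  beps_mul : forall x y, beps (amul x y) = beps x * beps y;
  beps_one : beps (aone bi_alg) = 1
}.

Definition is_antipode (H : Bialgebra) (S : H -> H) :=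
  [/\ klinear S,
      forall h, tli (fun x y => amul (S x) y) (bDelta h) = beps h *: aone H &
      forall h, tli (fun x y => amul x (S y)) (bDelta h) = beps h *: aone H].

Section OverH.
Variable H : Bialgebra.

Record ComodAlg := {
  ca_alg :> kAlgebra;
  rhoA : ca_alg -> tt H ca_alg;
  rhoA_linear : klinear rhoA;
  rhoA_coass : forall a, tassoc (tmap id rhoA (rhoA a)) = tmap (@bDelta H) id (rhoA a);
  rhoA_counit : forall a, tli (fun h x => beps h *: x) (rhoA a) = a;
  rhoA_mul : forall a b, rhoA (amul a b) = tact (@amul H) (@amul _) (rhoA a) (rhoA b);
  rhoA_one : rhoA (aone ca_alg) = tmu (aone H) (aone ca_alg)
}.

Record ModCoalg := {
  mc_sort :> lmodType k;
  cact : mc_sort -> H -> mc_sort;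
  cDelta : mc_sort -> tt mc_sort mc_sort;
  ceps : mc_sort -> k;
  cact_bilinear : kbilinear cact;
  cactA : forall c h h', cact c (amul h h') = cact (cact c h) h';
  cact1 : forall c, cact c (aone H) = c;
  mc_coalg : is_coalgebra cDelta ceps;
  cDelta_act : forall c h, cDelta (cact c h) = tact cact cact (cDelta c) (bDelta h);
  ceps_act : forall c h, ceps (cact c h) = ceps c * beps h
}.

Definition kflat (C : lmodType k) :=
  forall (M N : lmodType k) (f : M -> N), klinear f -> injective f ->
    injective (tmap (@id C) f).

End OverH.

Section AMod.
Variable A : kAlgebra.
Record AMod := {
  am_sort :> lmodType k;
  mact : am_sort -> A -> am_sort;
  mact_bilinear : kbilinear mact;
  mactA : forall m a b, mact m (amul a b) = mact (mact m a) b;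
  mact1 : forall m, mact m (aone A) = m
}.
Definition AHom (M N : AMod) (f : M -> N) :=
  klinear f /\ forall m a, f (mact m a) = mact (f m) a.
Definition AMono (N M : AMod) (i : N -> M) :=
  AHom i /\ forall (L : AMod) (f g : L -> N), AHom f -> AHom g ->
    (forall x, i (f x) = i (g x)) -> forall x, f x = g x.
Definition AEpi (X Y : AMod) (p : X -> Y) :=
  AHom p /\ forall (Z : AMod) (f g : Y -> Z), AHom f -> AHom g ->
    (forall x, f (p x) = g (p x)) -> forall y, f y = g y.
Definition A_semisimple (M : AMod) :=
  forall (N : AMod) (i : N -> M), AMono i ->
    exists r : M -> N, AHom r /\ forall x, r (i x) = x.
Definition A_projective (M : AMod) :=
  forall (X Y : AMod) (p : X -> Y) (f : M -> Y), AEpi p -> AHom f ->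
    exists g : M -> X, AHom g /\ forall m, p (g m) = f m.
Definition A_injective (M : AMod) :=
  forall (X Y : AMod) (i : X -> Y) (f : X -> M), AMono i -> AHom f ->
    exists g : Y -> M, AHom g /\ forall x, g (i x) = f x.
End AMod.

Section DHMod.
Variables (H : Bialgebra) (A : ComodAlg H) (C : ModCoalg H).

Record DHMod := {
  dh_amod :> AMod A;
  rhoM : dh_amod -> tt C dh_amod;
  rhoM_linear : klinear rhoM;
  rhoM_coass : forall m, tassoc (tmap id rhoM (rhoM m)) = tmap (@cDelta _ C) id (rhoM m);
  rhoM_counit : forall m, tli (fun c x => ceps c *: x) (rhoM m) = m;
  rhoM_act : forall m a, rhoM (mact m a) = tact (@cact _ C) (@mact _ _) (rhoM m) (rhoA a)
}.

Definition DHHom (M N : DHMod) (f : M -> N) :=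
  AHom f /\ forall m, rhoM (f m) = tmap id f (rhoM m).
Definition DHMono (N M : DHMod) (i : N -> M) :=
  DHHom i /\ forall (L : DHMod) (f g : L -> N), DHHom f -> DHHom g ->
    (forall x, i (f x) = i (g x)) -> forall x, f x = g x.
Definition DHEpi (X Y : DHMod) (p : X -> Y) :=
  DHHom p /\ forall (Z : DHMod) (f g : Y -> Z), DHHom f -> DHHom g ->
    (forall x, f (p x) = g (p x)) -> forall y, f y = g y.
Definition DH_semisimple (M : DHMod) :=
  forall (N : DHMod) (i : N -> M), DHMono i ->
    exists r : M -> N, DHHom r /\ forall x, r (i x) = x.
Definition DH_projective (M : DHMod) :=
  forall (X Y : DHMod) (p : X -> Y) (f : M -> Y), DHEpi p -> DHHom f ->
    exists g : M -> X, DHHom g /\ forall m, p (g m) = f m.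
Definition DH_injective (M : DHMod) :=
  forall (X Y : DHMod) (i : X -> Y) (f : X -> M), DHMono i -> DHHom f ->
    exists g : Y -> M, DHHom g /\ forall x, g (i x) = f x.

(* The forgetful functor F : ^C M(H)_A -> M_A is separable: there is a
   left inverse P of F on Hom-sets, natural in both variables. *)
Definition forget_separable :=
  exists P : forall M N : DHMod, (M -> N) -> (M -> N),
    [/\ forall (M N : DHMod) (f : M -> N), AHom f -> DHHom (P M N f),
        forall (M N : DHMod) (f : M -> N), DHHom f -> forall m, P M N f m = f m &
        forall (M M' N N' : DHMod) (a : M' -> M) (b : N -> N') (f : M -> N),
          DHHom a -> DHHom b -> AHom f ->
          forall m, P M' N' (fun x => b (f (a x))) m = b (P M N f (a m))].

(* A-integrals gamma : C -> Hom(C, A), written as a bilinear map C -> C -> A.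
   (i)  sum a_<0> gamma(c.a_<-2>)(d.a_<-1>) = gamma(c)(d) a, where
        a_<-2> (x) a_<-1> (x) a_<0> = (id (x) rho_A) rho_A (a);
   (ii) sum c_(1) (x) gamma(c_(2))(d)
          = sum d_(2).gamma(c)(d_(1))_<-1> (x) gamma(c)(d_(1))_<0>. *)
Definition A_integral (g : C -> C -> A) :=
  [/\ kbilinear g,
      forall (a : A) (c d : C),
        tli (fun (h1 : H) (t : tt H A) =>
               tli (fun (h2 : H) (x : A) => amul x (g (cact c h1) (cact d h2))) t)
            (tmap id (@rhoA _ A) (rhoA a))
        = amul (g c d) a &
      forall c d : C,
        tmap id (fun c' => g c' d) (cDelta c)
        = tli (fun (d1 d2 : C) =>
                 tli (fun (h : H) (x : A) => tmu (cact d2 h) x) (rhoA (g c d1)))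
              (cDelta d)].

Definition total_A_integral (g : C -> C -> A) :=
  A_integral g /\ forall c : C, tli g (cDelta c) = ceps c *: aone A.

End DHMod.
End Ops.

(* Main.v *)
(* Given a total A-integral [g], the A-linear map [f] is averaged to
     P(f)(m) = sum f(m_<0>)_<0> g(m_<-1>)(f(m_<0>)_<-1>);
   condition (i) makes it A-linear, condition (ii) C-colinear, and totality
   gives [P(f) = f] on morphisms.

   Conversely, C (x) - is right adjoint to the forgetful functor, and applying
   a natural [P] to the counits eps_M : C (x) M -> M gives natural retractions
   nu_M of the coactions.  With E := C (x) A put
     g(c)(d) := (eps (x) id) nu_E (c (x) (d (x) 1)).
   Naturality in left multiplications of A on E gives (i).  For (ii), let T be
   C (x) A with A acting on the right factor only; naturality along
   Delta (x) id and (- (x) d) (x) id from T to (C (x) C) (x) A shows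
   nu_T (c (x) (d (x) 1)) = sum d_(2) (x) g(c)(d_(1)), and (ii) is the image of
   this under the morphism T -> E, d (x) x |-> sum d.x_<-1> (x) x_<0>.

   The Maschke statements follow by lifting A-linear maps through [P], once
   categorical monos and epis are known to be preserved by the forgetful
   functor.  Epis are, by the adjunction.  For a mono [i] with kernel K, the
   morphism C (x) K -> C (x) N -> N (the second map being nu_N) composes with
   [i] to 0, hence vanishes; by flatness rho(x) lies in C (x) K for x in K, so
   x = nu_N (rho x) = 0. *)
Require Import Defs.
From HB Require Import structures.
From mathcomp Require Import all_boot all_algebra.
From Stdlib Require Import FunctionalExtensionality ClassicalEpsilon.
Import GRing.Theory.
Local Open Scope ring_scope.

Set Implicit Arguments.
Unset Strict Implicit.
Unset Printing Implicit Defensive.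

(** * Tensor calculus by universal property *)

Section LinearMaps.
Context {k : comPzRingType}.
Implicit Types M N P Q : lmodType k.

Definition ktrilinear M N P Q (F : M -> N -> P -> Q) :=
  [/\ forall y z, klinear (fun x => F x y z),
      forall x z, klinear (fun y => F x y z) &
      forall x y, klinear (fun z => F x y z)].

Lemma klin_id M : klinear (fun x : M => x).
Proof. by []. Qed.

Lemma klin_eta M N (f : M -> N) : klinear (fun x => f x) -> klinear f.
Proof. by []. Qed.

Lemma klin_comp M N P (g : N -> P) (f : M -> N) :
  klinear g -> klinear f -> klinear (fun x => g (f x)).
Proof. by move=> gL fL a x y; rewrite fL gL. Qed.

Lemma klin_bil_l M N P Q (op : N -> P -> Q) (f : M -> N) p :
  kbilinear op -> klinear f -> klinear (fun x => op (f x) p).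
Proof. by move=> [opL _] fL a x y; rewrite fL opL. Qed.

Lemma klin_bil_r M N P Q (op : N -> P -> Q) (f : M -> P) n :
  kbilinear op -> klinear f -> klinear (fun x => op n (f x)).
Proof. by move=> [_ opL] fL a x y; rewrite fL opL. Qed.

Lemma klin_scale_l M N P (e : N -> k) (f : M -> N) (v : P) :
  kfunctional e -> klinear f -> klinear (fun x => e (f x) *: v).
Proof. by move=> eL fL a x y; rewrite fL eL scalerDl scalerA. Qed.

Lemma klin_scale_r M P (a : k) (f : M -> P) :
  klinear f -> klinear (fun x => a *: f x).
Proof.
by move=> fL b x y; rewrite fL scalerDr !scalerA [a * b]mulrC.
Qed.

Lemma klin0 M N (f : M -> N) : klinear f -> f 0 = 0.
Proof.
by move=> fL; apply: (addrI (f 0)); rewrite addr0 -{1}[f 0]scale1r -fL scale1r addr0.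
Qed.

Lemma klinZ M N (f : M -> N) a x : klinear f -> f (a *: x) = a *: f x.
Proof. by move=> fL; rewrite -[a *: x]addr0 fL klin0 // addr0. Qed.

Lemma klin_const0 M N : klinear (fun _ : M => 0 : N).
Proof. by move=> a x y; rewrite scaler0 addr0. Qed.

End LinearMaps.

Section TensorCalculus.
Context {k : comPzRingType} {tp : tensor_provider k}.
Implicit Types M N P Q : lmodType k.

Lemma tmu_bil M N : kbilinear (@tmu k tp M N).
Proof. exact: tmul_bilinear. Qed.

Lemma tli_linear M N P (f : M -> N -> P) :
  kbilinear f -> klinear (tli (tp := tp) f).
Proof. exact: tlift_linear. Qed.

Lemma tli_tmu M N P (f : M -> N -> P) m n :
  kbilinear f -> tli f (tmu tp m n) = f m n.
Proof. by move=> fB; apply: tlift_tmul. Qed.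

Lemma tt_ext M N P (g h : tt tp M N -> P) : klinear g -> klinear h ->
  (forall m n, g (tmu tp m n) = h (tmu tp m n)) -> forall t, g t = h t.
Proof. exact: tens_ext. Qed.

(** [tlift] acts on bare functions, so this congruence rests on functional extensionality; it serves
    [under] as the rule for rewriting inside Sweedler sums. *)
Lemma eq_tli M N P (f g : M -> N -> P) (t : tt tp M N) :
  (forall m n, f m n = g m n) -> tli f t = tli g t.
Proof.
move=> fg; congr (tli _ t); apply: functional_extensionality => m.
exact: functional_extensionality.
Qed.

Lemma lin_tli M N P Q (h : P -> Q) (f : M -> N -> P) (t : tt tp M N) :
  klinear h -> kbilinear f -> h (tli f t) = tli (fun m n => h (f m n)) t.
Proof.
move=> hL [f1 f2].
have hfB : kbilinear (fun m n => h (f m n)).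
  by split=> z; apply: (klin_comp hL).
apply: (@tt_ext _ _ _ (fun t => h (tli f t))) => [||m n]; last by rewrite !tli_tmu.
  exact: (klin_comp hL (tli_linear _)).
exact: tli_linear.
Qed.

Lemma tli_param (X : lmodType k) M N P (f : X -> M -> N -> P) (t : tt tp M N) :
  ktrilinear f -> klinear (fun x => tli (f x) t).
Proof.
move=> [f1 f2 f3] a x y.
have fB z : kbilinear (f z) by split.
apply: (@tt_ext _ _ _ _ (fun t => a *: tli (f x) t + tli (f y) t)) => [||m n].
- exact: tli_linear.
- move=> b u v; rewrite !tli_linear // !scalerDr !scalerA [a * b]mulrC.
  by rewrite !addrA; congr (_ + _); rewrite -!addrA; congr (_ + _); rewrite addrC.
- by rewrite !tli_tmu //; apply: f1.
Qed.

Lemma tli_id M N (t : tt tp M N) : tli (tmu tp (N := N)) t = t.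
Proof.
apply: (tt_ext (tli_linear (tmu_bil _ _)) (@klin_id _ _)) => m n.
by rewrite tli_tmu //; apply: tmu_bil.
Qed.

End TensorCalculus.

Lemma cDelta_linear k (tp : tensor_provider k) (H : Bialgebra tp) (C : ModCoalg H) :
  klinear (@cDelta k tp H C).
Proof. by case: (mc_coalg C). Qed.

Lemma ceps_functional k (tp : tensor_provider k) (H : Bialgebra tp) (C : ModCoalg H) :
  kfunctional (@ceps k tp H C).
Proof. by case: (mc_coalg C). Qed.

Lemma bDelta_linear k (tp : tensor_provider k) (H : Bialgebra tp) :
  klinear (@bDelta k tp H).
Proof. by case: (bi_coalg H). Qed.

Lemma beps_functional k (tp : tensor_provider k) (H : Bialgebra tp) :
  kfunctional (@beps k tp H).
Proof. by case: (bi_coalg H). Qed.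

Tactic Notation "lin_bil" uconstr(H) :=
  first [refine (klin_bil_l _ H _) | refine (klin_bil_r _ H _)].

(* Proves [klinear] and [kbilinear] goals by recursion on the syntax of the
   map; the linearity of variables is looked up in the context. *)
Ltac lin :=
  intros; cbv beta delta [tmap tact tassoc];
  try refine (klin_eta _); cbv beta;
  lazymatch goal with
  | |- ktrilinear _ => split; lin
  | |- kbilinear _ => split; lin
  | |- klinear (fun x => x) => exact (@klin_id _ _)
  | |- klinear (fun x => tli _ _) =>
      first [refine (klin_comp (tli_linear _) _) | refine (tli_param _ _)]; lin
  | |- klinear (fun x => tmu _ _ _) => lin_bil (@tmu_bil _ _ _ _); lin
  | |- klinear (fun x => amul _ _) => lin_bil (amul_bilinear _); lin
  | |- klinear (fun x => mact _ _) => lin_bil (mact_bilinear _); lin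
  | |- klinear (fun x => cact _ _) => lin_bil (cact_bilinear _); lin
  | |- klinear (fun x => rhoA (@?f x)) => refine (klin_comp (@rhoA_linear _ _ _ _) _); lin
  | |- klinear (fun x => rhoM (@?f x)) => refine (klin_comp (@rhoM_linear _ _ _ _ _ _) _); lin
  | |- klinear (fun x => cDelta (@?f x)) => refine (klin_comp (@cDelta_linear _ _ _ _) _); lin
  | |- klinear (fun x => bDelta (@?f x)) => refine (klin_comp (@bDelta_linear _ _ _) _); lin
  | |- klinear (fun x => _ *: _) =>
      first [refine (klin_scale_r _ _)
            | refine (klin_scale_l _ (@ceps_functional _ _ _ _) _)
            | refine (klin_scale_l _ (@beps_functional _ _ _) _)]; lin
  | H : klinear ?h |- klinear (fun x => ?h (@?f x)) => refine (klin_comp H _); lin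
  | H : AHom ?h |- klinear (fun x => ?h (@?f x)) => refine (klin_comp (proj1 H) _); lin
  | H : DHHom ?h |- klinear (fun x => ?h (@?f x)) =>
      refine (klin_comp (proj1 (proj1 H)) _); lin
  | H : kbilinear ?h |- klinear (fun x => ?h _ _) => lin_bil H; lin
  | H : ktrilinear ?h |- klinear (fun x => ?h _ _ _) =>
      let H1 := fresh in let H2 := fresh in let H3 := fresh in
      case: (H) => H1 H2 H3;
      first [refine (klin_comp (H1 _ _) _) | refine (klin_comp (H2 _ _) _)
            | refine (klin_comp (H3 _ _) _)]; clear H1 H2 H3; lin
  | |- klinear _ => idtac
  | _ => fail "not a linearity goal"
  end.

(** * Computation rules for Sweedler sums *)

Section SweedlerRules.
Context {k : comPzRingType} {tp : tensor_provider k}.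
Implicit Types M N P Q X Y Z : lmodType k.

Lemma tli_tli M N X Y P (F : X -> Y -> P) (G : M -> N -> tt tp X Y)
    (t : tt tp M N) :
  kbilinear F -> kbilinear G ->
  tli F (tli G t) = tli (fun m n => tli F (G m n)) t.
Proof. by move=> FB GB; apply: lin_tli => //; apply: tli_linear. Qed.

Lemma bil_tli_l M N X Y P (op : X -> Y -> P) (G : M -> N -> X) (t : tt tp M N) y :
  kbilinear op -> kbilinear G ->
  op (tli G t) y = tli (fun m n => op (G m n) y) t.
Proof. by move=> [opL _] GB; apply: (lin_tli (h := op^~ y)). Qed.

Lemma bil_tli_r M N X Y P (op : X -> Y -> P) (G : M -> N -> Y) (t : tt tp M N) x :
  kbilinear op -> kbilinear G ->
  op x (tli G t) = tli (fun m n => op x (G m n)) t.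
Proof. by move=> [_ opL] GB; apply: lin_tli. Qed.

Lemma tmap_tmu M N X Y (f : M -> X) (g : N -> Y) m n :
  klinear f -> klinear g -> tmap f g (tmu tp m n) = tmu tp (f m) (g n).
Proof. by move=> fL gL; rewrite /tmap tli_tmu //; lin. Qed.

Lemma tli_tmap M N X Y P (F : X -> Y -> P) (f : M -> X) (g : N -> Y)
    (t : tt tp M N) :
  kbilinear F -> klinear f -> klinear g ->
  tli F (tmap f g t) = tli (fun m n => F (f m) (g n)) t.
Proof.
move=> FB fL gL; rewrite /tmap tli_tli //; last by lin.
by apply: eq_tli => m n; rewrite tli_tmu.
Qed.

Lemma tli_tact X1 X2 X3 Y1 Y2 Y3 P (F : X3 -> Y3 -> P)
    (f : X1 -> X2 -> X3) (g : Y1 -> Y2 -> Y3) (t : tt tp X1 Y1) (s : tt tp X2 Y2) :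
  kbilinear F -> kbilinear f -> kbilinear g ->
  tli F (tact f g t s) =
  tli (fun x1 y1 => tli (fun x2 y2 => F (f x1 x2) (g y1 y2)) s) t.
Proof.
move=> FB fB gB; rewrite /tact tli_tli //; last by lin.
apply: eq_tli => x1 y1; rewrite tli_tli //; last by lin.
by apply: eq_tli => x2 y2; rewrite tli_tmu.
Qed.

(** Fubini for two Sweedler sums. The two hypotheses together express linearity in each of the four
    arguments. *)
Lemma tli_swap M N X Y P (F : M -> N -> X -> Y -> P) (t : tt tp M N) (s : tt tp X Y) :
  (forall m n, kbilinear (F m n)) -> (forall x y, kbilinear (fun m n => F m n x y)) ->
  tli (fun m n => tli (F m n) s) t = tli (fun x y => tli (fun m n => F m n x y) t) s.
Proof.
move=> FB1 FB2.
have lin_t x y : klinear (fun t => tli (tp := tp) (fun m n => F m n x y) t).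
  exact: tli_linear.
have lin_s m n : klinear (fun s => tli (tp := tp) (F m n) s) by apply: tli_linear.
have bil_xy t' : kbilinear (fun x y => tli (tp := tp) (fun m n => F m n x y) t').
  split=> [y|x]; apply: tli_param; split=> u v.
  - exact: (proj1 (FB1 u v)).
  - exact: (proj1 (FB2 u y)).
  - exact: (proj2 (FB2 u y)).
  - exact: (proj2 (FB1 u v)).
  - exact: (proj1 (FB2 x u)).
  - exact: (proj2 (FB2 x u)).
have bil_mn s' : kbilinear (fun m n => tli (tp := tp) (F m n) s').
  split=> [n|m]; apply: tli_param; split=> u v.
  - exact: (proj1 (FB2 u v)).
  - exact: (proj1 (FB1 u n)).
  - exact: (proj2 (FB1 u n)).
  - exact: (proj2 (FB2 u v)).
  - exact: (proj1 (FB1 m u)).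
  - exact: (proj2 (FB1 m u)).
move: t; apply: tt_ext => [||m n].
- exact: (tli_linear (bil_mn s)).
- by apply: tli_param; split=> [x y|t y|t x]; [|case: (bil_xy t)|case: (bil_xy t)].
- by rewrite tli_tmu //; apply: eq_tli => x y; rewrite tli_tmu.
Qed.

Lemma tli_tassoc M N X P (F : tt tp M N -> X -> P) (t : tt tp M (tt tp N X)) :
  kbilinear F ->
  tli F (tassoc t) = tli (fun m u => tli (fun n x => F (tmu tp m n) x) u) t.
Proof.
move=> FB; rewrite /tassoc tli_tli //; last by lin.
apply: eq_tli => m u; rewrite tli_tli //; last by lin.
by apply: eq_tli => n x; rewrite tli_tmu.
Qed.

(** The map on triple tensors induced by [F] is applied to both sides of the coassociativity
    identity. Keeping [D], [r], [t] and [t'] independent covers the comultiplication and all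
    coactions at once. *)
Lemma coass_tli X Y Z M N P (F : X -> Y -> N -> P) (D : Z -> tt tp X Y)
    (r : M -> tt tp Y N) (t : tt tp X M) (t' : tt tp Z N) :
  ktrilinear F -> klinear D -> klinear r ->
  tassoc (tmap id r t) = tmap D id t' ->
  tli (fun x m => tli (F x) (r m)) t =
  tli (fun z n => tli (fun x y => F x y n) (D z)) t'.
Proof.
move=> FT DL rL /(congr1 (tli (fun u n => tli (fun x y => F x y n) u))).
have FB n : kbilinear (fun x y => F x y n) by lin.
rewrite tli_tassoc ?tli_tmap; try by lin.
by move<-; apply: eq_tli => x m; apply: eq_tli => y n; rewrite tli_tmu.
Qed.

End SweedlerRules.

(** * Coassociativity in Sweedler form and the counit laws of [C] *)

Section DoiHopf.
Context {k : comPzRingType} {tp : tensor_provider k} {H : Bialgebra tp}.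

Lemma tli_cDelta_coass (C : ModCoalg H) (P : lmodType k) (F : C -> C -> C -> P) c :
  ktrilinear F ->
  tli (fun c1 c' => tli (F c1) (cDelta c')) (cDelta c) =
  tli (fun c' c3 => tli (fun c1 c2 => F c1 c2 c3) (cDelta c')) (cDelta c).
Proof.
by move=> FT; apply: coass_tli => //; try lin; case: (mc_coalg C) => ? ? ->.
Qed.

Lemma tli_rhoA_coass (A : ComodAlg H) (P : lmodType k) (F : H -> H -> A -> P) a :
  ktrilinear F ->
  tli (fun h x => tli (F h) (rhoA x)) (rhoA a) =
  tli (fun h x => tli (fun h1 h2 => F h1 h2 x) (bDelta h)) (rhoA a).
Proof. by move=> FT; apply: coass_tli => //; try lin; apply: rhoA_coass. Qed.

Lemma tli_rhoM_coass (A : ComodAlg H) (C : ModCoalg H) (M : DHMod A C)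
    (P : lmodType k) (F : C -> C -> M -> P) m :
  ktrilinear F ->
  tli (fun c x => tli (F c) (rhoM x)) (rhoM m) =
  tli (fun c x => tli (fun c1 c2 => F c1 c2 x) (cDelta c)) (rhoM m).
Proof. by move=> FT; apply: coass_tli => //; try lin; apply: rhoM_coass. Qed.

Lemma tli_ceps_l (C : ModCoalg H) (c : C) :
  tli (fun c1 c2 => ceps c1 *: c2) (cDelta c) = c.
Proof. by case: (mc_coalg C). Qed.

Lemma tli_ceps_r (C : ModCoalg H) (c : C) :
  tli (fun c1 c2 => ceps c2 *: c1) (cDelta c) = c.
Proof. by case: (mc_coalg C). Qed.

End DoiHopf.

(** * Cofree and coinduced Doi-Hopf modules *)

Section Objects.
Context {k : comPzRingType} {tp : tensor_provider k} {H : Bialgebra tp}.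
Context {A : ComodAlg H} {C : ModCoalg H}.
Implicit Types V W P : lmodType k.

Definition is_comodule W (r : W -> tt tp C W) :=
  [/\ klinear r,
      forall w, tassoc (tmap id r (r w)) = tmap (@cDelta _ _ _ C) id (r w) &
      forall w, tli (fun c x => ceps c *: x) (r w) = w].

Lemma regular_comodule : is_comodule (@cDelta _ _ _ C).
Proof. by case: (mc_coalg C). Qed.

Lemma tli_comodule_coass W (r : W -> tt tp C W) P (F : C -> C -> W -> P) w :
  is_comodule r -> ktrilinear F ->
  tli (fun c x => tli (F c) (r x)) (r w) =
  tli (fun c x => tli (fun c1 c2 => F c1 c2 x) (cDelta c)) (r w).
Proof. by move=> [rL rA _] FT; apply: coass_tli => //; lin. Qed.

(** This is [Delta (x) id], rebracketed. *)
Definition cofree_coact V (t : tt tp C V) : tt tp C (tt tp C V) :=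
  tli (fun c v => tli (fun c1 c2 => tmu tp c1 (tmu tp c2 v)) (cDelta c)) t.

Lemma cofree_coact_linear V : klinear (@cofree_coact V).
Proof. by rewrite /cofree_coact; lin. Qed.

Lemma cofree_coact_tmu V c (v : V) :
  cofree_coact (tmu tp c v) = tli (fun c1 c2 => tmu tp c1 (tmu tp c2 v)) (cDelta c).
Proof. by rewrite /cofree_coact tli_tmu //; lin. Qed.

Lemma cofree_comodule V : is_comodule (@cofree_coact V).
Proof.
have rL := @cofree_coact_linear V.
split=> //; apply: tt_ext; try (by lin); move=> c v.
- rewrite cofree_coact_tmu.
  rewrite /tmap (tli_tli (tp := tp)); try by lin.
  rewrite [RHS]tli_tli; try by lin.
  rewrite [LHS]lin_tli; try by lin.
  transitivity (tli (fun c1 c' => tli (fun c2 c3 =>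
      tmu tp (tmu tp c1 c2) (tmu tp c3 v)) (cDelta c')) (cDelta c)).
    apply: eq_tli => c1 c'; rewrite tli_tmu ?cofree_coact_tmu; try by lin.
    rewrite (bil_tli_r _ _ (@tmu_bil _ _ _ _)); last by lin.
    rewrite [LHS]lin_tli; try by lin.
    apply: eq_tli => c2 c3; rewrite /tassoc tli_tmu ?tli_tmu //; lin.
  rewrite tli_cDelta_coass; last by lin.
  apply: eq_tli => c' c3; rewrite tli_tmu; try by lin.
  rewrite -(bil_tli_l (op := @tmu _ tp _ _)) ?tli_id //; first exact: tmu_bil.
  by lin.
- rewrite cofree_coact_tmu tli_tli; try by lin.
  under eq_tli => c1 c2.
    rewrite tli_tmu; last by lin.
    rewrite -(klinZ _ _ (proj1 (@tmu_bil _ tp _ _) v)).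
    over.
  rewrite -(bil_tli_l (op := @tmu _ tp _ _)) ?tli_ceps_l //; first exact: tmu_bil.
  by lin.
Qed.

(** The map [eps (x) id], counit of the adjunction between forgetting the coaction and [C (x) -]. *)
Definition counit_lift V (t : tt tp C V) : V := tli (fun c v => ceps c *: v) t.

Lemma counit_lift_linear V : klinear (@counit_lift V).
Proof. by rewrite /counit_lift; lin. Qed.

Lemma counit_lift_tmu V c (v : V) : counit_lift (tmu tp c v) = ceps c *: v.
Proof. by rewrite /counit_lift tli_tmu //; lin. Qed.

Lemma counit_lift_map V W (u : V -> W) t : klinear u ->
  counit_lift (tmap id u t) = u (counit_lift t).
Proof.
move=> uL; have e1 := @counit_lift_linear V; have e2 := @counit_lift_linear W.
move: t; apply: tt_ext; try (by lin); move=> c v.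
by rewrite /tmap tli_tmu ?counit_lift_tmu ?klinZ //; lin.
Qed.

(** A triangle identity of the adjunction, reducing to the right counit law of [C]. It recovers an
    element of [C (x) V] from its coaction. *)
Lemma counit_lift_cofree_coact V (t : tt tp C V) :
  tmap id (@counit_lift V) (cofree_coact t) = t.
Proof.
have eL := @counit_lift_linear V; have rL := @cofree_coact_linear V.
move: t; apply: tt_ext; try (by lin); move=> c v.
rewrite cofree_coact_tmu lin_tli; try by lin.
under eq_tli => c1 c2.
  rewrite /tmap tli_tmu; last by lin.
  rewrite counit_lift_tmu (klinZ _ _ (proj2 (@tmu_bil _ tp _ _) c1)).
  rewrite -(klinZ _ _ (proj1 (@tmu_bil _ tp _ _) v)).
  over.
rewrite -(bil_tli_l (op := @tmu _ tp _ _)) ?tli_ceps_r //; first exact: tmu_bil.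
by lin.
Qed.

(** * The cofree Doi-Hopf module [C (x) L], with diagonal action of [A] *)

Section Cofree.
Variable L : AMod A.

Definition cofree_act (t : tt tp C L) (a : A) : tt tp C L :=
  tact (@cact _ _ _ C) (@mact _ _ L) t (rhoA a).

Lemma cofree_act_bilinear : kbilinear cofree_act.
Proof. by rewrite /cofree_act; lin. Qed.

Lemma cofree_act_tmu c l a :
  cofree_act (tmu tp c l) a = tli (fun h b => tmu tp (cact c h) (mact l b)) (rhoA a).
Proof. by rewrite /cofree_act /tact tli_tmu //; lin. Qed.

Lemma cofree_actA t a b :
  cofree_act t (amul a b) = cofree_act (cofree_act t a) b.
Proof.
have B := cofree_act_bilinear.
move: t; apply: tt_ext; try (by lin); move=> c l.
rewrite !cofree_act_tmu rhoA_mul tli_tact; try by lin.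
rewrite (bil_tli_l _ _ B); last by lin.
apply: eq_tli => h x; rewrite cofree_act_tmu.
by apply: eq_tli => h' x'; rewrite cactA mactA.
Qed.

Lemma cofree_act1 t : cofree_act t (aone A) = t.
Proof.
have B := cofree_act_bilinear.
move: t; apply: tt_ext; try (by lin); move=> c l.
by rewrite cofree_act_tmu rhoA_one tli_tmu ?cact1 ?mact1 //; lin.
Qed.

Definition cofree_AMod : AMod A :=
  Build_AMod cofree_act_bilinear cofree_actA cofree_act1.

(* Both sides are [sum c_(1).a_<-2> (x) (c_(2).a_<-1> (x) q a_<0>)]. *)
Lemma cofree_coact_compat V (c : C) (q : A -> V) a : klinear q ->
  cofree_coact (tli (fun h b => tmu tp (cact c h) (q b)) (rhoA a)) =
  tli (fun c1 c2 => tli (fun h b => tmu tp (cact c1 h)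
     (tli (fun h' b' => tmu tp (cact c2 h') (q b')) (rhoA b))) (rhoA a)) (cDelta c).
Proof.
move=> qL; have rL := @cofree_coact_linear V.
rewrite lin_tli; try by lin.
under eq_tli => h b.
  rewrite cofree_coact_tmu cDelta_act tli_tact; try by lin.
  over.
rewrite tli_swap; try by lin.
apply: eq_tli => c1 c2.
under [RHS]eq_tli => h b.
  rewrite (bil_tli_r _ _ (@tmu_bil _ _ _ _)); last by lin.
  over.
by rewrite tli_rhoA_coass //; lin.
Qed.

Lemma cofree_coact_act (t : tt tp C L) a :
  cofree_coact (cofree_act t a) =
  tact (@cact _ _ _ C) cofree_act (cofree_coact t) (rhoA a).
Proof.
have B := cofree_act_bilinear; have rL := @cofree_coact_linear L.
move: t; apply: tt_ext; try (by lin); move=> c l.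
rewrite cofree_act_tmu (@cofree_coact_compat _ c (mact l) a); last by lin.
rewrite cofree_coact_tmu /tact tli_tli; try by lin.
apply: eq_tli => c1 c2; rewrite tli_tmu; last by lin.
by apply: eq_tli => h b; rewrite cofree_act_tmu.
Qed.

Definition cofree : DHMod A C :=
  @Build_DHMod _ _ _ A C cofree_AMod (@cofree_coact L) (@cofree_coact_linear L)
    (let: And3 _ p _ := cofree_comodule L in p)
    (let: And3 _ _ p := cofree_comodule L in p) cofree_coact_act.

(** Linearity over [A] comes from [eps(c.h) = eps(c) eps(h)] and [sum eps(a_<-1>) a_<0> = a]. *)
Lemma counit_lift_AHom : AHom (@counit_lift L : cofree -> L).
Proof.
have epsL := @counit_lift_linear L; have B := cofree_act_bilinear.
split=> // t a; change (counit_lift (cofree_act t a) = mact (counit_lift t) a).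
move: t; apply: tt_ext; try (by lin); move=> c l.
rewrite cofree_act_tmu lin_tli; try by lin.
rewrite counit_lift_tmu.
under eq_tli => h b.
  rewrite counit_lift_tmu ceps_act -scalerA.
  rewrite -!(klinZ _ _ (proj2 (mact_bilinear _) _)).
  over.
rewrite -[LHS](lin_tli (h := fun z => mact l (ceps c *: z))); try by lin.
by rewrite rhoA_counit (klinZ _ _ (proj2 (mact_bilinear _) _))
  -(klinZ _ _ (proj1 (mact_bilinear _) _)).
Qed.

End Cofree.

Lemma cofree_map_DHHom (L L' : AMod A) (u : L -> L') :
  AHom u -> DHHom (tmap id u : cofree L -> cofree L').
Proof.
move=> uH; have B := cofree_act_bilinear L; have B' := cofree_act_bilinear L'.
have rL := @cofree_coact_linear L; have rL' := @cofree_coact_linear L'.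
have mL : klinear (tmap (tp := tp) (id : C -> C) u) by lin.
split=> [|t].
  split=> // t a.
  change (tmap id u (cofree_act t a) = cofree_act (tmap id u t) a).
  move: t; apply: tt_ext; try (by lin); move=> c l.
  rewrite cofree_act_tmu lin_tli; try by lin.
  rewrite /tmap tli_tmu ?cofree_act_tmu; last by lin.
  by apply: eq_tli => h b; rewrite tli_tmu ?(proj2 uH) //; lin.
change (cofree_coact (tmap id u t) = tmap id (tmap id u) (cofree_coact t)).
move: t; apply: tt_ext; try (by lin); move=> c l.
rewrite cofree_coact_tmu [RHS]lin_tli; try by lin.
rewrite /tmap tli_tmu ?cofree_coact_tmu; last by lin.
by apply: eq_tli => c1 c2; rewrite !tli_tmu //; lin.
Qed.

(** Coassociativity of [r], read as colinearity of [r] into the cofree comodule; applied both to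
    [rhoM] and to the comultiplication of [C]. *)
Lemma comodule_coact_colinear W (r : W -> tt tp C W) w : is_comodule r ->
  cofree_coact (r w) = tmap id r (r w).
Proof.
move=> rC; have [rL _ _] := rC.
rewrite -[RHS]tli_id tli_tmap; try by lin.
rewrite /cofree_coact -tli_comodule_coass //; last by lin.
apply: eq_tli => c x; rewrite -[in RHS](tli_id (r x)).
by rewrite (bil_tli_r _ _ (@tmu_bil _ _ _ _)) //; lin.
Qed.

Lemma rhoM_DHHom (M : DHMod A C) : DHHom (@rhoM _ _ _ _ _ M : M -> cofree M).
Proof.
split=> [|m]; first by split; [lin | apply: rhoM_act].
apply: (comodule_coact_colinear (r := @rhoM _ _ _ _ _ M)).
by split; [lin | apply: rhoM_coass | apply: rhoM_counit].
Qed.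

(** * The Doi-Hopf module [W (x) A] on a [C]-comodule [W] *)

Section Coinduced.
Variables (W : lmodType k) (r : W -> tt tp C W).
Hypothesis rC : is_comodule r.
Let rL : klinear r. Proof. by case: rC. Qed.

Definition coind_act (t : tt tp W A) (a : A) : tt tp W A :=
  tmap id (fun x => amul x a) t.

Lemma coind_act_bilinear : kbilinear coind_act.
Proof. by rewrite /coind_act; lin. Qed.

Lemma coind_act_tmu w x a : coind_act (tmu tp w x) a = tmu tp w (amul x a).
Proof. by rewrite /coind_act /tmap tli_tmu //; lin. Qed.

Lemma coind_actA t a b : coind_act t (amul a b) = coind_act (coind_act t a) b.
Proof.
have B := coind_act_bilinear.
move: t; apply: tt_ext; try (by lin); move=> w x.
by rewrite !coind_act_tmu amulA.
Qed.

Lemma coind_act1 t : coind_act t (aone A) = t.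
Proof.
have B := coind_act_bilinear.
move: t; apply: tt_ext; try (by lin); move=> w x.
by rewrite !coind_act_tmu amulr1.
Qed.

Definition coind_AMod : AMod A :=
  Build_AMod coind_act_bilinear coind_actA coind_act1.

Definition coind_coact (t : tt tp W A) : tt tp C (tt tp W A) :=
  tli (fun w x => tli (fun c w' => tli (fun h x' =>
    tmu tp (cact c h) (tmu tp w' x')) (rhoA x)) (r w)) t.

Lemma coind_coact_linear : klinear coind_coact.
Proof. by rewrite /coind_coact; lin. Qed.

Lemma coind_coact_tmu w x :
  coind_coact (tmu tp w x) = tli (fun c w' => tli (fun h x' =>
    tmu tp (cact c h) (tmu tp w' x')) (rhoA x)) (r w).
Proof. by rewrite /coind_coact tli_tmu //; lin. Qed.

(** Coassociativity of [r] and of [rhoA] splits the legs separately; [Delta(c.h) = sum c_(1).h_(1)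
    (x) c_(2).h_(2)] then merges them. *)
Lemma coind_coass t :
  tassoc (tmap id coind_coact (coind_coact t)) =
  tmap (@cDelta _ _ _ C) id (coind_coact t).
Proof.
have RL := coind_coact_linear.
move: t; apply: tt_ext; try (by lin); move=> w x.
rewrite coind_coact_tmu.
pose F c h c' h' w' x' := tmu tp (tmu tp (@cact _ _ _ C c h) (@cact _ _ _ C c' h'))
  (tmu tp w' x') : tt tp (tt tp C C) (tt tp W A).
transitivity (tli (fun c w' => tli (fun c' w'' => tli (fun h x' => tli (fun h' x'' =>
    F c h c' h' w'' x'') (rhoA x')) (rhoA x)) (r w')) (r w)).
  rewrite lin_tli; try by lin.
  rewrite lin_tli; try by lin.
  apply: eq_tli => c w'.
  rewrite tli_swap; try by rewrite /F; lin.
  rewrite lin_tli; try by lin.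
  rewrite lin_tli; try by lin.
  apply: eq_tli => h x'.
  rewrite /tmap tli_tmu; last by lin.
  rewrite coind_coact_tmu (bil_tli_r _ _ (@tmu_bil _ _ _ _)); last by lin.
  rewrite [LHS]lin_tli; try by lin.
  apply: eq_tli => c' w''.
  rewrite (bil_tli_r _ _ (@tmu_bil _ _ _ _)); last by lin.
  rewrite [LHS]lin_tli; try by lin.
  apply: eq_tli => h' x''.
  by rewrite /tassoc tli_tmu ?tli_tmu //; lin.
rewrite (tli_comodule_coass _ rC); last by rewrite /F; lin.
rewrite [RHS]lin_tli; try by lin.
apply: eq_tli => c w'.
under [LHS]eq_tli => c1 c2.
  rewrite tli_rhoA_coass; last by rewrite /F; lin.
  over.
rewrite tli_swap; try by rewrite /F; lin.
rewrite [RHS]lin_tli; try by lin.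
apply: eq_tli => h x'.
rewrite /tmap tli_tmu; last by lin.
rewrite -[cDelta (cact c h)]tli_id cDelta_act tli_tact; try by lin.
rewrite (bil_tli_l _ _ (@tmu_bil _ _ _ _)); last by lin.
apply: eq_tli => c1 c2.
by rewrite (bil_tli_l _ _ (@tmu_bil _ _ _ _)) //; lin.
Qed.

Lemma coind_counit t : tli (fun c x => ceps c *: x) (coind_coact t) = t.
Proof.
have RL := coind_coact_linear.
move: t; apply: tt_ext; try (by lin); move=> w x.
rewrite coind_coact_tmu tli_tli; try by lin.
under eq_tli => c w'.
  rewrite tli_tli; try by lin.
  under eq_tli => h x'.
    rewrite tli_tmu; last by lin.
    rewrite ceps_act -scalerA -(klinZ _ _ (proj2 (@tmu_bil _ tp _ _) w')).
    over.
  rewrite -[tli _ _](lin_tli (h := fun z => ceps c *: tmu tp w' z)); try by lin.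
  rewrite rhoA_counit -(klinZ _ _ (proj1 (@tmu_bil _ tp _ _) x)).
  over.
rewrite -(bil_tli_l (op := @tmu _ tp _ _)); [|exact: tmu_bil|by lin].
by case: rC => _ _ ->.
Qed.

Lemma coind_coact_act t a :
  coind_coact (coind_act t a) = tact (@cact _ _ _ C) coind_act (coind_coact t) (rhoA a).
Proof.
have RL := coind_coact_linear; have B := coind_act_bilinear.
move: t; apply: tt_ext; try (by lin); move=> w x.
rewrite coind_act_tmu !coind_coact_tmu [RHS]lin_tli; try by lin.
apply: eq_tli => c w'.
rewrite rhoA_mul tli_tact; try by lin.
rewrite [RHS]lin_tli; try by lin.
apply: eq_tli => h x'; rewrite /tact tli_tmu; last by lin.
by apply: eq_tli => h' a'; rewrite cactA coind_act_tmu.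
Qed.

(* Unlike in [cofree], [A] acts on the right factor only, so that the
   coaction of [A] has to enter the coaction of [W (x) A] instead. *)
Definition coind : DHMod A C :=
  @Build_DHMod _ _ _ A C coind_AMod coind_coact coind_coact_linear
    coind_coass coind_counit coind_coact_act.

End Coinduced.

Lemma coind_map_DHHom W W' (r : W -> tt tp C W) (r' : W' -> tt tp C W')
    (rC : is_comodule r) (rC' : is_comodule r') (u : W -> W') :
  klinear u -> (forall w, r' (u w) = tmap id u (r w)) ->
  DHHom (tmap u id : coind rC -> coind rC').
Proof.
move=> uL ur; have B := coind_act_bilinear W; have B' := coind_act_bilinear W'.
have [rL _ _] := rC; have [rL' _ _] := rC'.
have RL := coind_coact_linear rC; have RL' := coind_coact_linear rC'.
have mL : klinear (tmap (tp := tp) u (id : A -> A)) by lin.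
split=> [|t].
  split=> // t a.
  change (tmap u id (coind_act t a) = coind_act (tmap u id t) a).
  move: t; apply: tt_ext; try (by lin); move=> w x.
  rewrite coind_act_tmu /tmap !tli_tmu ?coind_act_tmu //; lin.
change (coind_coact r' (tmap u id t) = tmap id (tmap u id) (coind_coact r t)).
move: t; apply: tt_ext; try (by lin); move=> w x.
rewrite coind_coact_tmu // [RHS]lin_tli; try by lin.
rewrite {1}/tmap tli_tmu ?coind_coact_tmu //; last by lin.
rewrite ur tli_tmap; try by lin.
apply: eq_tli => c w'; rewrite [RHS]lin_tli; try by lin.
by apply: eq_tli => h x'; rewrite /tmap !tli_tmu //; lin.
Qed.

Definition regular_AMod (B : kAlgebra k) : AMod B :=
  @Build_AMod _ B B (@amul _ B) (amul_bilinear B) (@amulA _ B) (@amulr1 _ B).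

Definition coind_to_cofree (t : tt tp C A) : tt tp C A :=
  tli (fun d x => tli (fun h x' => tmu tp (cact d h) x') (rhoA x)) t.

Lemma coind_to_cofree_linear : klinear coind_to_cofree.
Proof. by rewrite /coind_to_cofree; lin. Qed.

Lemma coind_to_cofree_tmu d x : coind_to_cofree (tmu tp d x) =
  tli (fun h x' => tmu tp (cact d h) x') (rhoA x).
Proof. by rewrite /coind_to_cofree tli_tmu //; lin. Qed.

(** Linearity over [A] is multiplicativity of [rhoA]; colinearity is [cofree_coact_compat] with [q]
    the identity of [A]. *)
Lemma coind_to_cofree_DHHom :
  DHHom (coind_to_cofree : coind regular_comodule -> cofree (regular_AMod A)).
Proof.
have L := coind_to_cofree_linear; have B := coind_act_bilinear C.
have B' := cofree_act_bilinear (regular_AMod A).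
have RL := coind_coact_linear regular_comodule.
have RL' := @cofree_coact_linear A.
split=> [|t].
  split=> // t a.
  change (coind_to_cofree (coind_act t a) =
    cofree_act (L := regular_AMod A) (coind_to_cofree t) a).
  move: t; apply: tt_ext; try (by lin); move=> d x.
  rewrite coind_act_tmu !coind_to_cofree_tmu rhoA_mul tli_tact; try by lin.
  rewrite (bil_tli_l _ _ B'); last by lin.
  apply: eq_tli => h x'; rewrite (cofree_act_tmu (L := regular_AMod A)).
  by apply: eq_tli => h' a'; rewrite cactA.
change (cofree_coact (coind_to_cofree t) =
  tmap id coind_to_cofree (coind_coact (@cDelta _ _ _ C) t)).
move: t; apply: tt_ext; try (by lin); move=> d x.
rewrite coind_to_cofree_tmu (@cofree_coact_compat _ d id x); last by lin.
rewrite coind_coact_tmu; last exact: regular_comodule.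
rewrite [RHS]lin_tli; try by lin.
apply: eq_tli => d1 d2; rewrite [RHS]lin_tli; try by lin.
by apply: eq_tli => h x'; rewrite /tmap tli_tmu ?coind_to_cofree_tmu //; lin.
Qed.

Lemma counit_lift_coind_to_cofree t :
  counit_lift (coind_to_cofree t) = counit_lift t.
Proof.
have L := coind_to_cofree_linear; have eL := @counit_lift_linear A.
move: t; apply: tt_ext; try (by lin); move=> d x.
rewrite coind_to_cofree_tmu lin_tli; try by lin.
under eq_tli => h x'.
  rewrite counit_lift_tmu ceps_act -scalerA.
  over.
rewrite -[LHS](lin_tli (h := fun z => ceps d *: z)); try by lin.
by rewrite rhoA_counit counit_lift_tmu.
Qed.

End Objects.

(** * From total integrals to separability *)

Section IntegralToSeparable.
Context {k : comPzRingType} {tp : tensor_provider k} {H : Bialgebra tp}.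
Context {A : ComodAlg H} {C : ModCoalg H}.
Implicit Types M N : DHMod A C.

Lemma tli_DHHom M N (P : lmodType k) (F : C -> N -> P) (f : M -> N) m :
  kbilinear F -> DHHom f ->
  tli F (rhoM (f m)) = tli (fun c x => F c (f x)) (rhoM m).
Proof. by move=> FB fH; rewrite (proj2 fH) tli_tmap //; lin. Qed.

Lemma tli_rhoM_act M (P : lmodType k) (F : C -> M -> P) m a :
  kbilinear F ->
  tli F (rhoM (mact m a)) =
  tli (fun c x => tli (fun h b => F (cact c h) (mact x b)) (rhoA a)) (rhoM m).
Proof. by move=> FB; rewrite rhoM_act tli_tact //; lin. Qed.

Lemma DHHom_id M : DHHom (fun x : M => x).
Proof. by split=> // m; rewrite -[LHS]tli_id. Qed.

Definition integral_map (g : C -> C -> A) M N (f : M -> N) (m : M) : N :=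
  tli (fun c x => tli (fun d y => mact y (g c d)) (rhoM (f x))) (rhoM m).

Section Integral.
Variable g : C -> C -> A.
Hypothesis g_int : A_integral g.
Let g_bil : kbilinear g. Proof. by case: g_int. Qed.

(** Expanding the coactions of [m a] and then of [f(x) a_<0>] produces the three legs [a_<-2>],
    [a_<-1>], [a_<0>] of condition (i). *)
Lemma integral_map_AHom M N (f : M -> N) : AHom f -> AHom (integral_map g f).
Proof.
move=> fH; have [_ g_act _] := g_int.
split=> [|m a]; first by rewrite /integral_map; lin.
rewrite /integral_map tli_rhoM_act; last by lin.
rewrite (bil_tli_l _ _ (mact_bilinear _)); last by lin.
apply: eq_tli => c x.
rewrite (bil_tli_l _ _ (mact_bilinear _)); last by lin.
under eq_tli => h b.
  rewrite (proj2 fH) tli_rhoM_act; last by lin.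
  over.
(* The sum over the coaction of [f x] moves outside; for fixed [c] and [d] what remains is [y] acted
   on by the left side of (i). *)
rewrite tli_swap; try by lin.
apply: eq_tli => d y; rewrite -mactA -g_act.
rewrite tli_tmap; try by lin.
rewrite (bil_tli_r _ _ (mact_bilinear _)); last by lin.
apply: eq_tli => h b.
rewrite (bil_tli_r _ _ (mact_bilinear _)); last by lin.
by apply: eq_tli => h' b'; rewrite mactA.
Qed.

Lemma integral_map_colinear M N (f : M -> N) (m : M) : AHom f ->
  rhoM (integral_map g f m) = tmap id (integral_map g f) (rhoM m).
Proof.
move=> fH; have [_ _ g_coact] := g_int.
rewrite /integral_map /tmap.
under [RHS]eq_tli => c x.
  rewrite (bil_tli_r _ _ (@tmu_bil _ _ _ _)); last by lin.
  over.
rewrite tli_rhoM_coass; last by lin.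
rewrite (lin_tli _ (@rhoM_linear _ _ _ _ _ N)); last by lin.
apply: eq_tli => c x.
rewrite (lin_tli _ (@rhoM_linear _ _ _ _ _ N)); last by lin.
under [LHS]eq_tli => d y.
  rewrite rhoM_act -[tact _ _ _ _]tli_id tli_tact; try by lin.
  over.
rewrite tli_rhoM_coass; last by lin.
under [RHS]eq_tli => c1 c2.
  rewrite (bil_tli_r _ _ (@tmu_bil _ _ _ _)); last by lin.
  over.
rewrite [RHS]tli_swap; try by lin.
apply: eq_tli => d y.
(* The middle term is [sum c_(1) (x) y g(c_(2))(d)], that is, the left side of (ii) mapped by
   [id (x) (y -)]. *)
transitivity (tmap id (mact y) (tmap id (g^~ d) (cDelta c))).
  rewrite g_coact [RHS]lin_tli; try by lin.
  apply: eq_tli => d1 d2; rewrite [RHS]lin_tli; try by lin.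
  by apply: eq_tli => h b; rewrite /tmap tli_tmu //; lin.
by rewrite {1}/tmap tli_tmap //; lin.
Qed.

Lemma integral_map_DHHom M N (f : M -> N) : AHom f -> DHHom (integral_map g f).
Proof.
by move=> fH; split=> [|m]; [apply: integral_map_AHom | apply: integral_map_colinear].
Qed.

End Integral.

Lemma separable_of_total_integral (g : C -> C -> A) :
  total_A_integral g -> forget_separable A C.
Proof.
move=> [g_int g_tot]; have [g_bil _ _] := g_int.
exists (fun M N f => integral_map g f); split=> [M N f fH|M N f fH m|M M' N N' a b f aH bH fH m].
- exact: integral_map_DHHom.
- rewrite /integral_map.
  (* Colinearity of [f] and coassociativity turn the sum into [sum f(m_<0>) g(c_(1))(c_(2))] with
     [c = m_<-1>], where totality applies. *)
  under eq_tli => c x.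
    rewrite tli_DHHom //; last by lin.
    over.
  rewrite tli_rhoM_coass; last by lin.
  under eq_tli => c x.
    rewrite -(bil_tli_r (op := @mact _ _ _)) //; last exact: mact_bilinear.
    rewrite g_tot (klinZ _ _ (proj2 (mact_bilinear _) _)) mact1 -(klinZ _ _ (proj1 (proj1 fH))).
    over.
  by rewrite -lin_tli ?rhoM_counit //; lin.
- rewrite /integral_map tli_DHHom //; last by lin.
  rewrite (lin_tli _ (proj1 (proj1 bH))); last by lin.
  apply: eq_tli => c x.
  rewrite tli_DHHom //; last by lin.
  rewrite (lin_tli _ (proj1 (proj1 bH))); last by lin.
  by apply: eq_tli => d y; rewrite (proj2 (proj1 bH)).
Qed.

End IntegralToSeparable.

(** * From separability to total integrals *)

Section SeparableToIntegral.
Context {k : comPzRingType} {tp : tensor_provider k} {H : Bialgebra tp}.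
Context {A : ComodAlg H} {C : ModCoalg H}.
Implicit Types M N : DHMod A C.

(* [rhoM] is the unit of the adjunction between the forgetful functor and
   [C (x) -]; separability amounts to a natural splitting of it. *)
Definition natural_retraction (nu : forall M, cofree (C := C) M -> M) :=
  [/\ forall M, DHHom (nu M),
      forall M N (u : M -> N), DHHom u ->
        forall t : cofree (C := C) M, nu N (tmap id u t) = u (nu M t) &
      forall M m, nu M (rhoM m) = m].

(** The retraction is [P] applied to the counit [eps_M]. *)
Lemma separable_retraction :
  forget_separable A C -> exists nu, natural_retraction nu.
Proof.
move=> [P [P_hom P_id P_nat]].
exists (fun M => P (cofree M) M (@counit_lift _ _ _ C M)).
split=> [M|M N u uH t|M m].
- exact/P_hom/counit_lift_AHom.
- have eM := @counit_lift_AHom _ _ _ A C M; have eN := @counit_lift_AHom _ _ _ A C N.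
  have idH (L : DHMod A C) : DHHom (fun x : L => x) by apply: DHHom_id.
  (* [u eps_M] and [eps_N (id (x) u)] are the same map; naturality of [P] in the target and in the
     source evaluates [P] on it in two ways. *)
  rewrite -(P_nat _ _ _ _ _ _ _ (idH _) uH eM).
  rewrite -(P_nat _ _ _ _ _ _ _ (cofree_map_DHHom (proj1 uH)) (idH _) eN).
  congr (P _ _ _ t); apply: functional_extensionality => s.
  exact/counit_lift_map/(proj1 (proj1 uH)).
- have idH : DHHom (fun x : M => x) by apply: DHHom_id.
  (* [eps_M rho] is the identity by the counit law, hence a morphism that [P] fixes. *)
  rewrite -(P_nat _ _ _ _ _ _ _ (rhoM_DHHom M) idH (counit_lift_AHom _)).
  rewrite -[RHS](P_id _ _ _ idH); congr (P _ _ _ m).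
  by apply: functional_extensionality => s; apply: rhoM_counit.
Qed.

Section Retraction.
Variable nu : forall M, cofree (C := C) M -> M.
Hypothesis nuP : natural_retraction nu.
Let nu_hom M : DHHom (@nu M). Proof. by case: nuP. Qed.
Let nu_nat M N (u : M -> N) (t : cofree (C := C) M) : DHHom u -> nu (tmap id u t) = u (nu t).
Proof. by case: nuP => _ nat _ uH; apply: nat. Qed.
Let nu_rho M (m : M) : nu (rhoM m) = m. Proof. by case: nuP. Qed.
Let nu_lin M : klinear (@nu M). Proof. by case: (nu_hom M) => -[]. Qed.

Let E : DHMod A C := cofree (regular_AMod A).
Let unit_tens (d : C) : E := tmu tp d (aone A).
Let nu1 (c d : C) : E := @nu E (tmu tp c (unit_tens d)).

Definition retraction_integral (c d : C) : A := counit_lift (nu1 c d).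
Let g := retraction_integral.

Let nu1_bil : kbilinear nu1.
Proof. by have L := @nu_lin E; rewrite /nu1 /unit_tens; lin. Qed.

Lemma retraction_integral_bilinear : kbilinear g.
Proof.
have L := @counit_lift_linear _ _ _ C A; have B := nu1_bil.
by rewrite /g /retraction_integral; lin.
Qed.

Let lmul x : DHHom (tmap id (amul x) : E -> E).
Proof.
apply: (@cofree_map_DHHom _ _ _ _ _ (regular_AMod A) (regular_AMod A)).
by split=> [|y a]; [lin | apply: amulA].
Qed.

(** [c (x) (d (x) x)] arises from [c (x) (d (x) 1)] through left multiplication by [x], an
    endomorphism of [E], so naturality of [nu] applies. *)
Lemma retraction_integral_lmul x c d :
  amul x (g c d) = counit_lift (@nu E (tmu tp c (tmu tp d x : E))).
Proof.
rewrite /g /retraction_integral -counit_lift_map; last by lin.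
rewrite /nu1 -(nu_nat (M := E) (N := E) _ (lmul x)); congr (counit_lift (@nu E _)).
have L := proj1 (proj1 (lmul x)); rewrite tmap_tmu; try by lin.
by rewrite /unit_tens tmap_tmu ?amulr1 //; lin.
Qed.

(** The left side is [eps nu_E] evaluated at [(c (x) (d (x) 1)) a], and both maps are [A]-linear. *)
Lemma retraction_integral_act (a : A) (c d : C) :
  tli (fun h1 t => tli (fun h2 x => amul x (g (cact c h1) (cact d h2))) t)
    (tmap id (@rhoA _ _ _ A) (rhoA a)) = amul (g c d) a.
Proof.
have B := retraction_integral_bilinear; have L := @nu_lin E.
have eL := @counit_lift_linear _ _ _ C A.
rewrite tli_tmap; try by lin.
under eq_tli => h1 b.
  under eq_tli => h2 x.
    rewrite retraction_integral_lmul.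
    over.
  rewrite -(lin_tli (h := fun z => counit_lift (@nu E (tmu tp (cact c h1) z)))); try by lin.
  over.
rewrite -(lin_tli (h := fun z => counit_lift (@nu E z))); try by lin.
transitivity (counit_lift (@nu E (@mact _ _ (cofree E) (tmu tp c (unit_tens d)) a))); last first.
  rewrite (proj2 (proj1 (nu_hom E))).
  exact: (proj2 (counit_lift_AHom (C := C) (regular_AMod A))).
congr (counit_lift (@nu E _)).
transitivity (cofree_act (L := E) (tmu tp c (unit_tens d)) a); last by [].
rewrite cofree_act_tmu; apply: eq_tli => h b; congr (tmu _ _ _).
transitivity (cofree_act (L := regular_AMod A) (tmu tp d (aone A)) b); last by [].
rewrite cofree_act_tmu; apply: eq_tli => h' x; congr (tmu _ _ _).
by rewrite /= amul1.
Qed.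

(** [sum c_(1) (x) (c_(2) (x) 1)] is the coaction of [c (x) 1] in [E], which [nu_E] undoes. *)
Lemma retraction_integral_total c : tli g (cDelta c) = ceps c *: aone A.
Proof.
have L := @nu_lin E; have eL := @counit_lift_linear _ _ _ C A.
rewrite /g /retraction_integral /nu1.
rewrite -(lin_tli (h := fun z => counit_lift (@nu E z))); try by rewrite /unit_tens; lin.
rewrite -counit_lift_tmu -[tmu tp c (aone A)](nu_rho (M := E)).
by congr (counit_lift (@nu E _)); rewrite -[LHS]cofree_coact_tmu.
Qed.

Let T : DHMod A C := coind (A := A) (regular_comodule (C := C)).
Let T2 : DHMod A C := coind (A := A) (cofree_comodule (C := C) C).

(** The coaction on [C (x) C] is cofree, hence concerns the first factor only, and the second can
    carry a constant [d]. *)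
Let slot d : DHHom (tmap (fun c => tmu tp c d) id : T -> T2).
Proof.
apply: coind_map_DHHom; first by lin.
by move=> c; rewrite cofree_coact_tmu.
Qed.

Let comult : DHHom (tmap (@cDelta _ _ _ C) id : T -> T2).
Proof.
apply: coind_map_DHHom; first by lin.
by move=> c; apply/comodule_coact_colinear/regular_comodule.
Qed.

Let nuT (c d : C) : T := @nu T (tmu tp c (tmu tp d (aone A) : T)).

Let phi_nuT c d : coind_to_cofree (nuT c d) = nu1 c d.
Proof.
rewrite -(nu_nat (M := T) (N := E) _ (coind_to_cofree_DHHom (A := A))).
congr (@nu E _); rewrite /tmap tli_tmu; last first.
  by have L := @coind_to_cofree_linear _ _ _ A C; lin.
congr (tmu _ _ _); rewrite coind_to_cofree_tmu rhoA_one tli_tmu ?cact1 //; lin.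
Qed.

Let nuT_integral c d :
  nuT c d = tli (fun d1 d2 => tmu tp d2 (g c d1)) (cDelta d).
Proof.
have eL := @counit_lift_linear _ _ _ C A.
have L := @nu_lin T; have L2 := @nu_lin T2.
(* [q] is [eps (x) id (x) id]: it splits [Delta (x) id], while after [slot v] it leaves [v] and the
   counit of the rest. *)
pose q (t : tt tp (tt tp C C) A) : tt tp C A :=
  tli (fun u x => tli (fun e1 e2 => ceps e1 *: tmu tp e2 x) u) t.
have qL : klinear q by rewrite /q; lin.
have q_comult t : q (tmap (@cDelta _ _ _ C) id t) = t.
  move: t; apply: tt_ext; try (by lin); move=> e x.
  rewrite /q tli_tmap; try by lin.
  rewrite tli_tmu; last by lin.
  under eq_tli => e1 e2.
    rewrite -(klinZ _ _ (proj1 (@tmu_bil _ tp _ _) x)).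
    over.
  rewrite -(bil_tli_l (op := @tmu _ tp _ _)) ?tli_ceps_l //; first exact: tmu_bil.
  by lin.
have q_slot v t : q (tmap (fun c => tmu tp c v) id t) = tmu tp v (counit_lift t).
  move: t; apply: tt_ext; try (by lin); move=> e x.
  rewrite /q tli_tmap; try by lin.
  rewrite !tli_tmu ?counit_lift_tmu; try by lin.
  by rewrite (klinZ _ _ (proj2 (@tmu_bil _ tp _ _) v)).
(* Naturality along [comult] replaces [d] by [Delta(d)]; each term [d_(1) (x) d_(2)] then comes from
   [d_(1)] through [slot d2]. *)
rewrite -[LHS]q_comult -(nu_nat (M := T) (N := T2) _ comult).
rewrite {1}/tmap tli_tmu; last by lin.
rewrite /tmap tli_tmu; last by lin.
rewrite -[cDelta d in LHS]tli_id.
rewrite (bil_tli_l _ _ (@tmu_bil _ tp _ _)); last by lin.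
rewrite (lin_tli (h := fun z => q (@nu T2 (tmu tp c z)))); try by lin.
apply: eq_tli => d1 d2.
rewrite /g /retraction_integral -phi_nuT counit_lift_coind_to_cofree -q_slot.
congr q; rewrite -(nu_nat (M := T) (N := T2) _ (slot d2)); congr (@nu T2 _).
by rewrite /tmap !tli_tmu //; lin.
Qed.

Lemma retraction_integral_coact c d :
  tmap id (fun c' => g c' d) (cDelta c) =
  tli (fun d1 d2 => tli (fun h x => tmu tp (cact d2 h) x) (rhoA (g c d1))) (cDelta d).
Proof.
have B := retraction_integral_bilinear.
have L := @coind_to_cofree_linear _ _ _ A C.
(* Both sides equal [nu1 c d]: the right one through [phi_nuT], the left one by the triangle
   identity and colinearity of [nu_E]. *)
transitivity (nu1 c d : tt tp C A); last first.
  rewrite -phi_nuT nuT_integral lin_tli; try by lin.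
  by apply: eq_tli => d1 d2; rewrite coind_to_cofree_tmu.
rewrite -[RHS]counit_lift_cofree_coact.
have nuE := @nu_lin E.
have -> : cofree_coact (nu1 c d : tt tp C A) = rhoM (nu1 c d) by [].
rewrite /nu1 (proj2 (nu_hom E)).
have -> : rhoM (tmu tp c (unit_tens d) : cofree (C := C) E) =
  tli (fun c1 c2 => tmu tp c1 (tmu tp c2 (unit_tens d))) (cDelta c).
  exact: cofree_coact_tmu.
have eL := @counit_lift_linear _ _ _ C A.
rewrite [tmap id (@nu E) _]lin_tli; try by lin.
rewrite [RHS]lin_tli; try by lin.
by apply: eq_tli => c1 c2; rewrite /tmap !tli_tmu //; lin.
Qed.

Lemma retraction_total_integral : total_A_integral g.
Proof.
split; last exact: retraction_integral_total.
split; [exact: retraction_integral_bilinear | exact: retraction_integral_act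
  | exact: retraction_integral_coact].
Qed.

End Retraction.
End SeparableToIntegral.

(** * Preservation of monomorphisms and epimorphisms *)

Section Submodule.
Context {k : comPzRingType} {U : lmodType k} {S : {pred U}}.

(** The closure proof is a parameter of the type, so that instance inference can supply the module
    structure. *)
Definition submodule (S_closed : GRing.submod_closed S) := {x : U | x \in S}.

Variable S_closed : GRing.submod_closed S.

HB.instance Definition _ := [isSub of submodule S_closed for @sval _ _].
HB.instance Definition _ := [Choice of submodule S_closed by <:].
HB.instance Definition _ :=
  GRing.SubChoice_isSubLmodule.Build k U S (submodule S_closed)
    (GRing.submod_closed_semi S_closed).

End Submodule.

Section KernelImage.
Context {k : comPzRingType} {M N : lmodType k} {f : M -> N} (fL : klinear f).

Lemma ker_closed : GRing.submod_closed [pred x | f x == 0].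
Proof.
split=> [|a x y]; rewrite !inE ?klin0 //.
by move=> /eqP fx /eqP fy; rewrite fL fx fy scaler0 addr0.
Qed.

(** Subtypes are carved out by boolean predicates, so the existential is decided by excluded
    middle. *)
Definition in_image (y : N) : bool :=
  if excluded_middle_informative (exists x, f x = y) then true else false.

Lemma in_imageP y : reflect (exists x, f x = y) (in_image y).
Proof. by rewrite /in_image; case: excluded_middle_informative => h; constructor. Qed.

Lemma image_closed : GRing.submod_closed in_image.
Proof.
split=> [|a _ _ /in_imageP[x <-] /in_imageP[y <-]]; apply/in_imageP.
  by exists 0; rewrite klin0.
by exists (a *: x + y); rewrite fL.
Qed.

End KernelImage.

(** * Flatness and the kernel of [id (x) f] *)

Section Flatness.
Context {k : comPzRingType} {tp : tensor_provider k}.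

(* [psi] factors through [C (x) im f], and flatness embeds the latter into
   [C (x) N]; this avoids the quotient of [M] by the kernel of [f]. *)
Lemma flat_tmap_ker (C M N P : lmodType k) (f : M -> N) (psi : tt tp C M -> P) :
  kflat tp C -> klinear f -> klinear psi ->
  (forall c x, f x = 0 -> psi (tmu tp c x) = 0) ->
  forall t, tmap id f t = 0 -> psi t = 0.
Proof.
move=> C_flat fL psiL psi0 t ft0.
pose I : lmodType k := submodule (image_closed fL).
have inc_lin : klinear (\val : I -> N) by move=> a x y; rewrite linearP.
have f_in x : in_image (f := f) (f x) by apply/in_imageP; exists x.
pose f' x : I := Sub (f x) (f_in x).
have f'L : klinear f'.
  by move=> a x y; apply: val_inj; rewrite linearP /= fL.
have psi_eq c x y : f x = f y -> psi (tmu tp c x) = psi (tmu tp c y).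
  move=> fxy; apply/eqP; rewrite -subr_eq0 addrC -scaleN1r -psiL.
  rewrite -(proj2 (@tmu_bil _ tp _ _) c) psi0 //.
  by rewrite fL fxy scaleN1r addNr.
have pre_ex (y : I) : exists x, f x = val y by apply/in_imageP; apply: (valP y).
(* [pre] chooses preimages and need not be linear; [psi'] is bilinear all the same, because by
   [psi_eq] the value of [psi] depends only on the image under [f]. *)
pose pre y := sval (constructive_indefinite_description _ (pre_ex y)).
have preP y : f (pre y) = val y.
  by rewrite /pre; case: constructive_indefinite_description.
pose psi' (c : C) (y : I) := psi (tmu tp c (pre y)).
have psi'B : kbilinear psi'.
  split=> [y|c a y z]; rewrite /psi'; first by lin.
  rewrite -psiL -(proj2 (@tmu_bil _ tp _ _) c); apply: psi_eq.
  by rewrite fL !preP linearP.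
have f't0 : tmap id f' t = 0.
  apply: (C_flat _ _ _ inc_lin val_inj); rewrite klin0; last by lin.
  rewrite -[RHS]ft0 {1}/tmap tli_tmap //; lin.
transitivity (tli psi' (tmap id f' t)); last by rewrite f't0 klin0 //; lin.
rewrite tli_tmap // -[in LHS](tli_id t) lin_tli //; try by lin.
by apply: eq_tli => c x; apply: psi_eq; rewrite preP.
Qed.

End Flatness.

(** * Monos, epis and the lifting of linear maps to morphisms *)

Section Maschke.
Context {k : comPzRingType} {tp : tensor_provider k} {H : Bialgebra tp}.
Context {A : ComodAlg H} {C : ModCoalg H}.
Implicit Types M N X Y : DHMod A C.

Lemma tmap_id_comp (U V W X : lmodType k) (g : V -> W) (f : U -> V)
    (t : tt tp X U) : klinear g -> klinear f ->
  tmap id g (tmap id f t) = tmap id (fun x => g (f x)) t.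
Proof. by move=> gL fL; rewrite {1}/tmap tli_tmap //; lin. Qed.

Lemma tmap_id_eq0 (U V W : lmodType k) (f : V -> W) :
  klinear f -> (forall x, f x = 0) -> forall t : tt tp U V, tmap id f t = 0.
Proof.
move=> fL f0; apply: tt_ext; [by lin | exact: klin_const0 | move=> u v].
by rewrite tmap_tmu // f0 (klin0 (proj2 (@tmu_bil _ tp _ _) u)).
Qed.

Lemma DHHom_comp M N X (g : N -> X) (f : M -> N) :
  DHHom g -> DHHom f -> DHHom (fun x => g (f x)).
Proof.
move=> gH fH; split=> [|m].
  split=> [|m a]; first by lin.
  by rewrite (proj2 (proj1 fH)) (proj2 (proj1 gH)).
by rewrite (proj2 gH) (proj2 fH) tmap_id_comp //; lin.
Qed.

Lemma DHHom_0 M N : DHHom (fun _ : M => 0 : N).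
Proof.
split=> [|m].
  split=> [|m a]; first exact: klin_const0.
  by rewrite (klin0 (proj1 (mact_bilinear N) a)).
rewrite (klin0 (@rhoM_linear _ _ _ _ _ N)); apply: esym.
exact: (tmap_id_eq0 (@klin_const0 _ M N)).
Qed.

Section KernelAMod.
Variables (B : kAlgebra k) (M N : AMod B) (f : M -> N) (fH : AHom f).

Let K : lmodType k := submodule (ker_closed (proj1 fH)).

Lemma ker_mact_mem (x : K) a : mact (val x) a \in [pred x | f x == 0].
Proof.
rewrite inE (proj2 fH); have /eqP -> := valP x.
by rewrite (klin0 (proj1 (mact_bilinear N) a)).
Qed.

Definition ker_mact (x : K) a : K := Sub (mact (val x) a) (ker_mact_mem x a).

Lemma ker_mact_bilinear : kbilinear ker_mact.
Proof.
split=> [b a x y|x a b c]; apply: val_inj; rewrite [RHS]linearP.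
  exact: (proj1 (mact_bilinear M) b a (val x) (val y)).
exact: (proj2 (mact_bilinear M)).
Qed.

Lemma ker_mactA x a b : ker_mact x (amul a b) = ker_mact (ker_mact x a) b.
Proof. by apply: val_inj; apply: mactA. Qed.

Lemma ker_mact1 x : ker_mact x (aone B) = x.
Proof. by apply: val_inj; apply: mact1. Qed.

(** The kernel is formed among [A]-modules; the coaction used to test monos is that of the cofree
    module on it. *)
Definition ker_AMod : AMod B := Build_AMod ker_mact_bilinear ker_mactA ker_mact1.

Lemma ker_incl_AHom : AHom (\val : ker_AMod -> M).
Proof. by split=> // a x y; rewrite linearP. Qed.

End KernelAMod.

(** An [A]-linear [h] is recovered from its transpose [(id (x) h) rho] by applying [eps]; transposes
    are morphisms, so the epi [p] can be cancelled on them. *)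
Lemma DHEpi_AEpi X Y (p : X -> Y) : DHEpi p -> AEpi p.
Proof.
move=> [pH p_epi]; split=> [|Z f g fH gH fpgp y]; first exact: (proj1 pH).
have transpose_hom (h : Y -> Z) : AHom h ->
    DHHom (fun y => tmap id h (rhoM y) : cofree (C := C) Z).
  by move=> hH; apply: (DHHom_comp (cofree_map_DHHom hH) (rhoM_DHHom Y)).
have counit_transpose (h : Y -> Z) : AHom h ->
    counit_lift (tmap id h (rhoM y)) = h y.
  by move=> [hL _]; rewrite counit_lift_map // /counit_lift rhoM_counit.
rewrite -(counit_transpose f fH) -(counit_transpose g gH); congr counit_lift.
apply: (p_epi _ _ _ (transpose_hom f fH) (transpose_hom g gH)) => x.
rewrite (proj2 pH) !tmap_id_comp; try by lin.
by congr (tmap _ _ _); apply: functional_extensionality.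
Qed.

Lemma DHMono_AMono (nu : forall M, cofree (C := C) M -> M) N M (i : N -> M) :
  kflat tp C -> natural_retraction nu -> DHMono i -> AMono i.
Proof.
move=> C_flat [nu_hom nu_nat nu_rho] [iH i_mono].
pose K := ker_AMod (proj1 iH).
have incH : AHom (\val : K -> N) by apply: ker_incl_AHom.
have nuL := proj1 (proj1 (nu_hom N)).
have nu_ker (t : cofree (C := C) K) : nu N (tmap id (\val : K -> N) t) = 0.
  (* [i] is tested on this map and on zero: by naturality of [nu] both composites vanish, as [i]
     kills [K]. *)
  move: t; apply: (i_mono _ _ (fun=> 0)); last 1 first.
  - move=> t; rewrite -nu_nat // tmap_id_comp; [|by lin..].
    rewrite (klin0 (proj1 (proj1 iH))) -[RHS](klin0 (proj1 (proj1 (nu_hom M)))).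
    congr (nu M _); apply: tmap_id_eq0; first by lin.
    by move=> x; apply/eqP; apply: (valP x).
  - exact: DHHom_comp (nu_hom N) (cofree_map_DHHom incH).
  - exact: DHHom_0.
have i_ker x : i x = 0 -> x = 0.
  move=> ix0; rewrite -(nu_rho N x).
  (* Here [psi] is [nu_N] and the tensor is [rho(x)], with [(id (x) i) rho(x) = rho(i x) = 0]. *)
  apply: (flat_tmap_ker C_flat (proj1 (proj1 iH)) nuL); last first.
    by rewrite -(proj2 iH) ix0 klin0 //; lin.
  move=> c z iz0; have zK : z \in [pred x | i x == 0] by rewrite inE iz0.
  rewrite -[RHS](nu_ker (tmu tp c (Sub z zK : K))); congr (nu N _).
  by rewrite tmap_tmu //; lin.
split=> [|L f g fH gH ifg x]; first exact: (proj1 iH).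
apply/eqP; rewrite -subr_eq0 addrC -scaleN1r; apply/eqP/i_ker.
by rewrite (proj1 (proj1 iH)) ifg scaleN1r addNr.
Qed.

(** [P(g) i = P(g i) = P(f) = f] by naturality in the source. Retractions are the case where [f] is
    the identity. *)
Lemma separable_extend M X Y (i : X -> Y) (f : X -> M) (g : Y -> M) :
  forget_separable A C -> DHHom i -> DHHom f -> AHom g ->
  (forall x, g (i x) = f x) ->
  exists g' : Y -> M, DHHom g' /\ forall x, g' (i x) = f x.
Proof.
move=> [P [P_hom P_id P_nat]] iH fH gH gi; exists (P Y M g); split=> [|x].
  exact: P_hom.
rewrite -(P_nat _ _ _ _ _ _ _ iH (DHHom_id M) gH) -[RHS](P_id X M f) //.
by congr (P _ _ _ x); apply: functional_extensionality.
Qed.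

(** Dually, [p P(g) = P(p g) = P(f) = f]; sections are the case where [f] is the identity. *)
Lemma separable_lift M X Y (p : X -> Y) (f : M -> Y) (g : M -> X) :
  forget_separable A C -> DHHom p -> DHHom f -> AHom g ->
  (forall m, p (g m) = f m) ->
  exists g' : M -> X, DHHom g' /\ forall m, p (g' m) = f m.
Proof.
move=> [P [P_hom P_id P_nat]] pH fH gH pg; exists (P M X g); split=> [|m].
  exact: P_hom.
rewrite -(P_nat _ _ _ _ _ _ _ (DHHom_id M) pH gH) -[RHS](P_id M Y f) //.
by congr (P _ _ _ m); apply: functional_extensionality.
Qed.

End Maschke.

Theorem theorem2p1p5 (k : comPzRingType) (tp : tensor_provider k)
  (H : Bialgebra tp) (A : ComodAlg H) (C : ModCoalg H) (C_flat : kflat tp C) :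
  (* total A-integral => F separable *)
  ((exists g : C -> C -> A, total_A_integral g) -> forget_separable A C) /\
  (* H Hopf: F separable => total A-integral *)
  ((exists S : H -> H, is_antipode S) -> forget_separable A C ->
     exists g : C -> C -> A, total_A_integral g) /\
  (* in this situation: *)
  ((exists g : C -> C -> A, total_A_integral g) ->
     (forall (M N : DHMod A C) (u : M -> N), DHHom u ->
        ((exists r : N -> M, AHom r /\ forall m, r (u m) = m) ->
           exists r : N -> M, DHHom r /\ forall m, r (u m) = m) /\
        ((exists s : N -> M, AHom s /\ forall n, u (s n) = n) ->
           exists s : N -> M, DHHom s /\ forall n, u (s n) = n)) /\
     (forall M : DHMod A C,
        (A_semisimple M -> DH_semisimple M) /\
        (A_projective M -> DH_projective M) /\
        (A_injective M -> DH_injective M))).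
Proof.
split; first by move=> [g]; apply: separable_of_total_integral.
split.
  move=> _ /separable_retraction[nu nuP].
  by exists (retraction_integral nu); apply: retraction_total_integral.
move=> [g /separable_of_total_integral sep].
have [nu nuP] := separable_retraction sep.
split=> [M N u uH|M].
  split=> [[r [rH ru]]|[s [sH us]]].
    exact: (separable_extend sep uH (DHHom_id M) rH ru).
  exact: (separable_lift sep uH (DHHom_id N) sH us).
split=> [M_ss N i i_mono|].
  (* Flatness and [nu] make [i] a mono of [A]-modules; its linear retraction extends the identity of
     [N] along [i]. *)
  have [r [rH ri]] := M_ss _ _ (DHMono_AMono C_flat nuP i_mono).
  exact: (separable_extend sep (proj1 i_mono) (DHHom_id N) rH ri).
split=> [M_proj X Y p f p_epi fH|M_inj X Y i f i_mono fH].
  have [g' [g'H pg']] := M_proj _ _ _ _ (DHEpi_AEpi p_epi) (proj1 fH).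
  exact: (separable_lift sep (proj1 p_epi) fH g'H pg').
have [g' [g'H g'i]] := M_inj _ _ _ _ (DHMono_AMono C_flat nuP i_mono) (proj1 fH).
exact: (separable_extend sep (proj1 i_mono) fH g'H g'i).
Qed.
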